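(* Let $k\ge 0$ be an integer and let $G$ be a planar graph which is a minimal $k$-$\{1,2\}$-factor-critical graph. Then $k+1\le\delta(G)\le k+2$.
   Context: All graphs are finite, undirected and simple; $\delta(G)$ denotes the minimum degree of $G$. A $\{1,2\}$-factor of a graph $G$ is a spanning subgraph each of whose components is a regular graph of degree one or two (i.e. a single edge or a cycle). A graph $G$ of order $n$ is $k$-$\{1,2\}$-factor-critical (where $0\le k<n$) if for every set $T\subseteq V(G)$ with $|T|=k$, the graph $G-T$ has a $\{1,2\}$-factor. A $k$-$\{1,2\}$-factor-critical graph $G$ is minimal if for every edge $e\in E(G)$, the graph $G-e$ is not $k$-$\{1,2\}$-factor-critical. *)

(* Defs.v *)
From HB Require Import structures.
From mathcomp Require Export all_boot all_order all_algebra.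
From mathcomp Require Export all_classical all_reals all_analysis.

Set Implicit Arguments.
Unset Strict Implicit.
Unset Printing Implicit Defensive.

Import Order.TTheory GRing.Theory Num.Theory.
Import numFieldNormedType.Exports.

Record sgraph (V : finType) := SGraph {
  adj :> rel V;
  adj_sym : symmetric adj;
  adj_irr : irreflexive adj }.

Section Graphs.
Variable V : finType.
Implicit Types (G F : sgraph V) (T : {set V}) (e : {set V}) (k : nat).

Definition edges G : {set {set V}} :=
  [set e | [exists u, exists v, G u v && (e == [set u; v]%SET)]]%SET.

Definition degree G (v : V) : nat := #|[set w | G v w]%SET|.

(* Every degree is at most #|V|, so for nonempty V the default value #|V| does
   not affect the minimum. *)
Definition min_degree G : nat := \big[minn/#|V|]_(v : V) degree G v.

Lemma del_edge_sym G e : symmetric (fun x y => G x y && ([set x; y]%SET != e)).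
Proof. by move=> x y; rewrite adj_sym finset.setUC. Qed.

Lemma del_edge_irr G e : irreflexive (fun x y => G x y && ([set x; y]%SET != e)).
Proof. by move=> x; rewrite adj_irr. Qed.

Definition del_edge G e : sgraph V := SGraph (del_edge_sym G e) (del_edge_irr G e).

Lemma del_vertices_sym G T :
  symmetric (fun x y : {x : V | x \notin T} => G (val x) (val y)).
Proof. by move=> x y; rewrite adj_sym. Qed.

Lemma del_vertices_irr G T :
  irreflexive (fun x y : {x : V | x \notin T} => G (val x) (val y)).
Proof. by move=> x; rewrite adj_irr. Qed.

Definition del_vertices G T : sgraph {x : V | x \notin T} :=
  SGraph (@del_vertices_sym G T) (@del_vertices_irr G T).

Definition components F : {set {set V}} :=
  equivalence_partition (connect F) [set: V]%SET.

(* All F-neighbours of a vertex lie in its component, so its degree in the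
   component is its degree in F. *)
Definition is_12_factor G F : Prop :=
  subrel F G /\
  (forall C : {set V}, C \in components F ->
     exists2 d : nat, d = 1 \/ d = 2 & forall v, v \in C -> degree F v = d).

Definition has_12_factor G : Prop := exists F, is_12_factor G F.

End Graphs.

Section Critical.
Variables (V : finType) (k : nat).
Implicit Type G : sgraph V.

Definition factor_critical G : Prop :=
  k < #|V| /\
  (forall T : {set V}, #|T| = k -> has_12_factor (del_vertices G T)).

Definition minimal_factor_critical G : Prop :=
  factor_critical G /\
  (forall e : {set V}, e \in edges G -> ~ factor_critical (del_edge G e)).

End Critical.

Section Planarity.
Local Open Scope classical_set_scope.
Local Open Scope ring_scope.
Variables (R : realType) (V : finType).

Definition simple_arc (g : R -> R * R) : Prop :=
  {within `[0, 1], continuous g} /\ {in `[0, 1] &, injective g}.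

Definition arc_interior (g : R -> R * R) : set (R * R) := g @` `]0, 1[.

(* arc e is the curve representing the edge e, traversed in either direction *)
Definition is_plane_drawing (G : sgraph V)
    (pos : V -> R * R) (arc : {set V} -> R -> R * R) : Prop :=
  [/\ injective pos,
      forall e, e \in edges G ->
        simple_arc (arc e) /\ [set arc e 0; arc e 1] = pos @` [set` e],
      forall e, e \in edges G -> arc_interior (arc e) `&` range pos = set0
    & forall e f, e \in edges G -> f \in edges G -> e != f ->
        arc_interior (arc e) `&` arc_interior (arc f) = set0].

Definition planar (G : sgraph V) : Prop :=
  exists pos arc, is_plane_drawing G pos arc.

End Planarity.

(* Main.v *)
Require Import Defs.
From mathcomp Require Import all_boot zify.

Set Implicit Arguments.
Unset Strict Implicit.
Unset Printing Implicit Defensive.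

(* Write f(S) = |N(S)| - |S|.  By Hall's theorem in the bipartite double cover,
   G is k-{1,2}-factor-critical iff f(S) >= k for all nonempty independent S,
   and f is submodular.  Call an independent S tight if f(S) = k.  In a minimal
   graph every edge uv has a witness: either a tight set containing one end u,
   in which v has no neighbour but u (uv leaves u), or, for each end, an
   independent set containing it with the same property and f = k + 1.  If all
   degrees are at least k + 3, then uncrossing witnesses shows that a vertex of
   a tight set meets no edge of the second kind and is left by at most one edge,
   while any other vertex is left by none and meets at most two edges of the
   second kind.  Hence the degrees sum to at most 2n < 3n. *)

Local Open Scope nat_scope.
Local Open Scope set_scope.

(** * Neighbourhoods of sets and Hall's theorem *)

Section Neighbourhood.
Variables (T U : finType).
Implicit Types (r : T -> {set U}) (S A B : {set T}).

Definition nbh r S : {set U} := \bigcup_(x in S) r x.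

Lemma nbhP r S y : reflect (exists2 x, x \in S & y \in r x) (y \in nbh r S).
Proof. exact: bigcupP. Qed.

Lemma nbhS r A B : A \subset B -> nbh r A \subset nbh r B.
Proof.
move=> /subsetP sAB; apply/subsetP => y /nbhP[x xA yx].
by apply/nbhP; exists x => //; apply: sAB.
Qed.

Lemma nbh1 r x : nbh r [set x] = r x.
Proof. by rewrite /nbh big_set1. Qed.

Lemma nbhU r A B : nbh r (A :|: B) = nbh r A :|: nbh r B.
Proof.
apply/setP => y; rewrite inE; apply/nbhP/orP.
  by case=> x; rewrite inE => /orP[] xA yx; [left|right]; apply/nbhP; exists x.
by case=> /nbhP[x xA yx]; exists x => //; rewrite inE xA ?orbT.
Qed.

Lemma nbh_submodular r A B :
  #|nbh r (A :|: B)| + #|nbh r (A :&: B)| <= #|nbh r A| + #|nbh r B|.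
Proof.
rewrite nbhU -[X in _ <= X]cardsUI leq_add2l subset_leq_card // subsetI.
by rewrite !nbhS ?subsetIl ?subsetIr.
Qed.

(* Rado's argument: a family satisfying Hall's condition which is minimal
   consists of singletons. *)
Lemma hall r : (forall S : {set T}, #|S| <= #|nbh r S|) ->
  exists2 f : T -> U, injective f & forall x, f x \in r x.
Proof.
have [m] := ubnP (\sum_x #|r x|); elim: m r => // m IHm r lem hr.
have [x|small] := pickP (fun x => 1 < #|r x|); last first.
  have r1 x : exists y, r x == [set y].
    suff /cards1P[y ->] : #|r x| == 1 by exists y.
    rewrite eqn_leq leqNgt small /=.
    by have := hr [set x]; rewrite cards1 nbh1.
  exists (fun x => xchoose (r1 x)) => [x x' eqf|x]; last first.
    by rewrite {2}(eqP (xchooseP (r1 x))) set11.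
  apply/eqP/contraT => nxx'; have := hr [set x; x'].
  rewrite nbhU !nbh1 (eqP (xchooseP (r1 x))) (eqP (xchooseP (r1 x'))) -eqf.
  by rewrite setUid cards1 cards2 nxx'.
case/card_gt1P => y1 [y2 [y1x y2x ny]].
pose del y z := if z == x then r x :\ y else r z.
have delE y S : x \notin S -> nbh (del y) S = nbh r S.
  move=> xS; apply: eq_bigr => z zS; rewrite /del.
  by case: eqP xS zS => // -> /negbTE->.
have step y : y \in r x -> (forall S : {set T}, #|S| <= #|nbh (del y) S|) ->
    exists2 f : T -> U, injective f & forall x, f x \in r x.
  move=> yx hd; have [] := IHm (del y) => // [|f fi fd].
    rewrite ltnS in lem; apply: leq_trans lem.
    rewrite (bigD1 x) //= [X in _ < X](bigD1 x) //=.
    rewrite {1}/del eqxx (cardsD1 y (r x)) yx add1n addSn ltnS leq_add2l.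
    by apply: leq_sum => z zx; rewrite /del (negbTE zx).
  exists f => // z; have := fd z; rewrite /del.
  by case: eqP => // -> /setD1P[].
(* A set violating Hall's condition after the deletion must contain [x]; the [S] given here is that
   set without [x]. *)
have bad y : ~ (forall S : {set T}, #|S| <= #|nbh (del y) S|) ->
    exists2 S : {set T}, x \notin S & #|nbh r S :|: r x :\ y| <= #|S|.
  move/existsNP => [S /negP]; rewrite -ltnNge => ltS.
  have xS : x \in S.
    by apply: contraLR ltS => xS; rewrite -leqNgt delE.
  exists (S :\ x); first by rewrite setD11.
  move: ltS; rewrite [in X in _ < X](cardsD1 x S) xS add1n ltnS.
  rewrite -[in X in X <= _](setD1K xS) nbhU nbh1 delE ?setD11 // {1}/del eqxx.
  by rewrite setUC.
have [h1|/bad[S1 xS1 h1]] :=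
  pselect (forall S : {set T}, #|S| <= #|nbh (del y1) S|).
  exact: step h1.
have [h2|/bad[S2 xS2 h2]] :=
  pselect (forall S : {set T}, #|S| <= #|nbh (del y2) S|).
  exact: step h2.
have xS12 : x \notin S1 :|: S2 by rewrite inE negb_or xS1.
have hU : #|S1 :|: S2|.+1 <= #|nbh r (S1 :|: S2) :|: r x|.
  rewrite -(nbh1 r x) -nbhU (leq_trans _ (hr _)) //.
  by rewrite [_ :|: [set x]]setUC cardsU1 xS12.
(* As [y1 != y2], the union of the two sets regains all of [r x]. Counting union and intersection
   gives [#|S1| + #|S2| >= #|S1 :|: S2| + 1 + #|S1 :&: S2|], which is absurd. *)
have := cardsUI (nbh r S1 :|: r x :\ y1) (nbh r S2 :|: r x :\ y2).
have := cardsUI S1 S2; have := hr (S1 :&: S2).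
have : #|nbh r (S1 :|: S2) :|: r x| <=
    #|(nbh r S1 :|: r x :\ y1) :|: (nbh r S2 :|: r x :\ y2)|.
  apply/subset_leq_card/subsetP => z; rewrite nbhU !inE.
  case/orP => [/orP[]->|->]; rewrite ?orbT //= !andbT.
  by case: (eqVneq z y1) => [->|_]; rewrite ?ny ?orbT.
have : #|nbh r (S1 :&: S2)| <=
    #|(nbh r S1 :|: r x :\ y1) :&: (nbh r S2 :|: r x :\ y2)|.
  apply/subset_leq_card; rewrite subsetI.
  apply/andP; split; rewrite (subset_trans _ (subsetUl _ _)) // nbhS //.
    exact: subsetIl.
  exact: subsetIr.
lia.
Qed.

End Neighbourhood.

Lemma card_between (T : finType) (A B : {set T}) (m : nat) :
  A \subset B -> #|A| <= m -> m <= #|B| ->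
  exists C : {set T}, [/\ A \subset C, C \subset B & #|C| = m].
Proof.
move=> sAB; elim: m => [|m IHm] lAm lmB.
  by exists A; split=> //; apply/eqP; rewrite -leqn0.
have [eA|neA] := eqVneq #|A| m.+1; first by exists A.
have [||C [sAC sCB cC]] := IHm; [by lia|exact: ltnW|].
have /set0Pn[x] : B :\: C != set0.
  by rewrite -card_gt0 cardsD (setIidPr sCB) cC subn_gt0.
rewrite inE => /andP[xC xB]; exists (x |: C); split.
- exact: subset_trans sAC (subsetUr _ _).
- by rewrite subUset sub1set xB.
- by rewrite cardsU1 xC cC.
Qed.

(** * Independent sets and [{1,2}]-factors *)

Section Graph.
Variables (V : finType) (G : sgraph V).
Implicit Types (S A B I : {set V}) (u v x y : V).

Definition nb x : {set V} := [set y | G x y].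
Definition independent S := [forall x in S, forall y in S, ~~ G x y].

Lemma independentP S :
  reflect (forall x y, x \in S -> y \in S -> G x y = false) (independent S).
Proof.
apply: (iffP forall_inP) => h x.
  by move=> y xS yS; apply/negbTE; have /forall_inP := h x xS; apply.
by move=> xS; apply/forall_inP => y yS; rewrite h.
Qed.

Lemma independentS A B : A \subset B -> independent B -> independent A.
Proof.
move=> /subsetP sAB /independentP iB; apply/independentP => x y xA yA.
by apply: iB; apply: sAB.
Qed.

Lemma mem_nbh S y : (y \in nbh nb S) = [exists x in S, G x y].
Proof.
by apply/nbhP/exists_inP => -[x xS]; rewrite ?inE => xy; exists x; rewrite ?inE.
Qed.

Lemma independent_card_nbh S x : independent S -> x \in S -> x \notin nbh nb S.
Proof.
move=> /independentP iS xS; rewrite mem_nbh; apply/exists_inP => -[y yS].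
by rewrite iS.
Qed.

Definition isolated S := [set x in S | [forall y in S, ~~ G x y]].

Lemma isolated_independent S : independent (isolated S).
Proof.
apply/independentP => x y /setIdP[_ /forall_inP h] /setIdP[yS _].
exact/negbTE/h.
Qed.

(** A non-isolated vertex of [S] has a neighbour in [S], so it lies in [nbh nb S], yet no isolated
    vertex is adjacent to it. Passing to the isolated part thus never increases
    [#|nbh nb S| - #|S|]. *)
Lemma isolated_card S :
  #|nbh nb (isolated S)| + #|S :\: isolated S| <= #|nbh nb S|.
Proof.
rewrite -cardsUI (_ : _ :&: _ = set0) ?cards0 ?addn0.
  apply/subset_leq_card/subsetP => y; rewrite !inE => /orP[].
    by apply/subsetP/nbhS/subsetP => x /setIdP[].
  case/andP => + yS; rewrite yS /= => /forall_inPn[x xS].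
  by rewrite negbK mem_nbh adj_sym => xy; apply/exists_inP; exists x.
apply/setP => y; rewrite in_setI in_setD in_set0 mem_nbh.
apply/negP => /andP[/exists_inP[x /setIdP[_ /forall_inP hx] xy]] /andP[_ yS].
by have := hx y yS; rewrite xy.
Qed.

Lemma isolatedDcard S : #|S| = #|isolated S| + #|S :\: isolated S|.
Proof.
rewrite -(cardsID (isolated S) S) (setIidPr _) //.
by apply/subsetP => x /setIdP[].
Qed.

Lemma factor_card_nbh S : has_12_factor G -> #|S| <= #|nbh nb S|.
Proof.
case=> F [sFG regF].
have degF x : exists2 d, d = 1 \/ d = 2 &
    forall y, connect F x y -> degree F y = d.
  pose C := [set y in [set: V] | connect F x y].
  have [|d hd hC] := regF C; first by apply: imset_f; rewrite inE.
  by exists d => // y xy; apply: hC; rewrite !inE.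
(* Weighting x by 2 / degree F x turns the degree count into a bound. *)
pose w x := if degree F x == 1 then 2 else 1.
have wF x y : F x y -> w x = w y.
  by move=> /connect1 xy; have [d _ hd] := degF x; rewrite /w !hd.
have wE x : \sum_(y | F x y) w x = 2.
  rewrite sum_nat_const (_ : #|_| = degree F x); last by rewrite /degree cardsE.
  have [d hd /(_ x (connect0 F x))] := degF x.
  by rewrite /w => ->; case: hd => ->.
rewrite -(@leq_pmul2r 2) // -!sum_nat_const.
rewrite (eq_bigr (fun x => \sum_(y | F x y) w y)); last first.
  by move=> x _; rewrite -(wE x); apply: eq_bigr => y /wF.
(* Seen from [y], the weights received from [S] are part of the total [2] coming from all
   [F]-neighbours of [y]. *)
rewrite (exchange_big_dep (mem (nbh nb S))) /=; last first.
  by move=> x y xS /sFG xy; rewrite mem_nbh; apply/exists_inP; exists x.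
apply: leq_sum => y _; rewrite -[X in _ <= X](wE y).
rewrite [X in _ <= X](bigID (mem S)) /= addnC.
by rewrite (eq_bigl (fun x => F y x && (x \in S))) ?leq_addl // => x;
   rewrite andbC adj_sym.
Qed.

(** The 2-cycles of the permutation [p] become single edges and its longer cycles become cycles of
    the factor; [p (p x) = x] tells them apart and is constant on components. *)
Lemma factor_of_injection (p : V -> V) :
  injective p -> (forall x, G x (p x)) -> has_12_factor G.
Proof.
move=> pI Gp; pose f x y := (p x == y) || (p y == x).
have fs : symmetric f by move=> x y; rewrite /f orbC.
have fi : irreflexive f.
  move=> x; rewrite /f orbb; apply/eqP => px.
  by have := Gp x; rewrite px adj_irr.
have [q qK pK] := injF_bij pI.
have deg x : degree (SGraph fs fi) x = 1 + (p (p x) != x).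
  rewrite -(can_eq pK) qK add1n -cards2.
  by apply: eq_card => y; rewrite !inE /f /= (can2_eq qK pK y) eq_sym.
exists (SGraph fs fi); split=> [x y /orP[] /eqP <- //|C /imsetP[x _ ->]].
  by rewrite adj_sym.
exists (1 + (p (p x) != x)); first by case: eqP; [left|right].
move=> y; rewrite !inE /= deg => xy; congr (1 + ~~ _).
have cl : closed f [pred z | p (p z) == z].
  by move=> z t /orP[] /eqP <-; rewrite !inE (inj_eq pI).
by have := closed_connect cl xy; rewrite !inE.
Qed.

(** Hall's injection sends each vertex to a neighbour; [isolated_card] extends Hall's condition from
    independent sets to all sets. *)
Lemma has_factor :
  (forall S, independent S -> #|S| <= #|nbh nb S|) -> has_12_factor G.
Proof.
move=> h; have [S|p pI Gp] := @hall V V nb; last first.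
  by apply: (factor_of_injection pI) => x; have := Gp x; rewrite inE.
rewrite (isolatedDcard S) (leq_trans _ (isolated_card S)) // leq_add2r.
exact/h/isolated_independent.
Qed.

End Graph.

(** * Criticality as a surplus condition on independent sets *)

Section DeleteVertices.
Variables (V : finType) (G : sgraph V) (T : {set V}).
Let sV := {x : V | x \notin T}.
Implicit Types (S : {set sV}) (A : {set V}).

Lemma nbh_del_vertices S :
  val @: nbh (nb (del_vertices G T)) S = nbh (nb G) (val @: S) :\: T.
Proof.
apply/setP => y; rewrite inE mem_nbh; apply/imsetP/andP.
  case=> z; rewrite mem_nbh => /exists_inP[x xS xz] ->.
  split; first exact: (valP z).
  by apply/exists_inP; exists (val x); rewrite ?imset_f.
case=> yT /exists_inP[_ /imsetP[x xS ->] xy]; exists (Sub y yT) => //.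
by rewrite mem_nbh; apply/exists_inP; exists x.
Qed.

Lemma independent_del_vertices S :
  independent (del_vertices G T) S -> independent G (val @: S).
Proof.
move=> /independentP iS.
by apply/independentP => _ _ /imsetP[x xS ->] /imsetP[y yS ->]; apply: iS.
Qed.

Lemma card_nbhD A : [disjoint A & T] -> has_12_factor (del_vertices G T) ->
  #|A| <= #|nbh (nb G) A :\: T|.
Proof.
move=> dAT /factor_card_nbh h; pose S := [set x : sV | val x \in A].
have <- : val @: S = A.
  apply/setP => x; apply/imsetP/idP => [[y]|xA]; first by rewrite inE => ? ->.
  by exists (Sub x (negbT (disjointFr dAT xA))) => //; rewrite inE.
by rewrite -nbh_del_vertices !card_imset //; apply: val_inj.
Qed.

End DeleteVertices.

Section Surplus.
Variables (V : finType) (G : sgraph V) (k : nat).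
Implicit Types (S A B : {set V}) (u v x y : V).

Local Notation N := (nbh (nb G)).

(** Deleting [k] vertices of [N S], all outside [S], must leave [S] with at least [#|S|]
    neighbours. *)
Lemma critical_surplus S : factor_critical k G -> independent G S ->
  S != set0 -> #|S| + k <= #|N S|.
Proof.
case=> ltkV crit iS /set0Pn[x xS].
have [ltNk|leNk] := ltnP #|N S| k; last first.
  have [|T [_ sTN cT]] := card_between (sub0set (N S)) _ leNk.
    by rewrite cards0.
  have dST : [disjoint S & T].
    rewrite disjoint_sym; apply: disjointWl sTN _.
    apply/pred0P => y /=; apply/andP => -[+ yS]; apply/negP.
    exact: independent_card_nbh iS yS.
  have := card_nbhD dST (crit T cT).
  by rewrite cardsD (setIidPr sTN) cT leq_subRL // addnC.
(* If [#|N S| < k], a set [T] can contain all neighbours of [x] but not [x], which is then isolated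
   in a graph having a factor. *)
have [|||T [sNT sTx cT]] := @card_between _ (N [set x]) [set~ x] k.
- by rewrite subsetC sub1set inE nbh1 inE adj_irr.
- by apply: leq_trans (ltnW ltNk); rewrite subset_leq_card // nbhS // sub1set.
- by rewrite cardsC1; lia.
have dxT : [disjoint [set x] & T].
  by rewrite disjoints1; apply/negP => /(subsetP sTx); rewrite !inE eqxx.
have := card_nbhD dxT (crit T cT).
have /eqP-> : N [set x] :\: T == set0 by rewrite setD_eq0.
by rewrite cards1 cards0.
Qed.

Lemma surplus_critical : k < #|V| ->
  (forall S, independent G S -> S != set0 -> #|S| + k <= #|N S|) ->
  factor_critical k G.
Proof.
move=> ltkV h; split=> // T cT; apply: has_factor => S iS.
have [->|/set0Pn[x xS]] := eqVneq S set0; first by rewrite cards0.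
have := h _ (independent_del_vertices iS).
have -> : val @: S != set0 by apply/set0Pn; exists (val x); apply: imset_f.
move=> /(_ isT).
have cS (A : {set {x | x \notin T}}) : #|val @: A| = #|A|.
  by apply: card_imset; apply: val_inj.
rewrite cS -(cS (nbh _ S)) nbh_del_vertices cardsD => hS.
have := subset_leq_card (subsetIr (N (val @: S)) T); move: hS; rewrite cT; lia.
Qed.

End Surplus.

(** * Uncrossing tight and nearly tight sets *)

Section Tight.
Variables (V : finType) (G : sgraph V) (k : nat).
Implicit Types (S A B U D : {set V}) (u v x y : V).

Local Notation N := (nbh (nb G)).

Hypothesis surplus :
  forall S, independent G S -> S != set0 -> #|S| + k <= #|N S|.

Definition tight S := independent G S && (#|N S| == #|S| + k).

Lemma surplus_at u S : u \in S -> independent G S -> #|S| + k <= #|N S|.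
Proof. by move=> uS iS; apply: surplus => //; apply/set0Pn; exists u. Qed.

(** This serves for unions of independent sets, which need not be independent: one isolated vertex
    makes [surplus] applicable to the isolated part. *)
Lemma isolated_surplus u U : u \in isolated G U -> #|U| + k <= #|N U|.
Proof.
move=> uU; have := surplus_at uU (isolated_independent G U).
have := isolated_card G U; have := isolatedDcard G U; lia.
Qed.

Lemma isolated_tight u U : u \in isolated G U -> #|N U| <= #|U| + k ->
  tight (isolated G U).
Proof.
move=> uU leU; rewrite /tight isolated_independent /=.
have := surplus_at uU (isolated_independent G U).
have := isolated_card G U; have := isolatedDcard G U; lia.
Qed.

Lemma isolatedU u A B : independent G A -> independent G B ->
  u \in A -> u \in B -> u \in isolated G (A :|: B).
Proof.
move=> /independentP iA /independentP iB uA uB; rewrite !inE uA /=.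
by apply/forall_inP => y; rewrite inE => /orP[] yS; [rewrite iA|rewrite iB].
Qed.

(** Intersection and union both have surplus at least [k], the union because [u] is isolated in it,
    and by submodularity the two sum to at most [2k]. *)
Lemma tightI u A B : tight A -> tight B -> u \in A -> u \in B ->
  tight (A :&: B).
Proof.
move=> /andP[iA /eqP cA] /andP[iB /eqP cB] uA uB.
have iAB : independent G (A :&: B) := independentS (subsetIl A B) iA.
have uAB : u \in A :&: B by rewrite inE uA.
rewrite /tight iAB /=; have := surplus_at uAB iAB.
have := isolated_surplus (isolatedU iA iB uA uB).
have := nbh_submodular (nb G) A B; have := cardsUI A B; lia.
Qed.

(** [N S] contains [D] and, disjointly, [N (S :\ u)], which has at least [#|S| - 1 + k] elements. *)
Lemma private_card u S D : independent G S -> u \in S -> S != [set u] ->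
  D \subset nb G u -> [disjoint D & N (S :\ u)] ->
  #|S| + k + #|D| <= #|N S| + 1.
Proof.
move=> iS uS nSu sDu dD.
have h : #|S :\ u| + k <= #|N (S :\ u)|.
  apply: surplus; first by apply: independentS iS; apply: subD1set.
  by apply: contra nSu; rewrite setD_eq0 subset1 => /orP[//|/eqP S0];
    rewrite S0 inE in uS.
have : #|D :|: N (S :\ u)| <= #|N S|.
  rewrite subset_leq_card // subUset nbhS ?subD1set // andbT.
  by rewrite (subset_trans sDu) // -nbh1 nbhS // sub1set.
rewrite cardsU (disjoint_setI0 dD) cards0.
have := cardsD1 u S; rewrite uS; lia.
Qed.

(** Deleting the edge removes [v] from [N S], so the surplus of the tight set [S] falls below
    [k]. *)
Definition out u v := G u v &&
  [exists S : {set V}, [&& tight S, u \in S & v \notin N (S :\ u)]].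

(** Models a set violating the surplus condition after deletion and containing both ends: [A] is
    that set without [v]. *)
Definition nearly_out u v := G u v &&
  [exists A : {set V}, [&& independent G A, u \in A, v \notin N (A :\ u),
     #|N A| <= #|A| + k + 1 & nb G v \subset u |: N A]].

Lemma outP u v S : G u v -> tight S -> u \in S -> v \notin N (S :\ u) ->
  out u v.
Proof.
by move=> uv tS uS vS; rewrite /out uv; apply/existsP; exists S; apply/and3P.
Qed.

(** Two such neighbours are both private to [u] in the tight intersection of their witnesses, where
    [private_card] allows one. If that intersection is [[set u]], the degree of [u] is only
    [k + 1]. *)
Lemma out_card u : k + 2 <= #|nb G u| -> #|[set v | out u v]| <= 1.
Proof.
move=> du; rewrite leqNgt; apply/card_gt1P => -[v1 [v2 []]].
rewrite !inE => /andP[uv1 /existsP[S1 /and3P[t1 u1 p1]]].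
move=> /andP[uv2 /existsP[S2 /and3P[t2 u2 p2]]] nv.
have /andP[iS /eqP cS] := tightI t1 t2 u1 u2.
have uS : u \in S1 :&: S2 by rewrite inE u1.
have [S_u|nS] := eqVneq (S1 :&: S2) [set u].
  by move: cS du; rewrite S_u nbh1 cards1; clear; lia.
have sD : [set v1; v2] \subset nb G u by rewrite subUset !sub1set !inE uv1.
have dD : [disjoint [set v1; v2] & N ((S1 :&: S2) :\ u)].
  rewrite disjoints_subset subUset !sub1set !in_setC.
  by rewrite (contra _ p1) ?(contra _ p2) // => /(subsetP (nbhS _ _)); apply;
    apply: setSD; rewrite ?subsetIl ?subsetIr.
by have := private_card iS uS nS sD dD; rewrite cards2 nv cS leq_add2l.
Qed.

(* With S the least tight set containing u, the isolated part of A :|: S is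
   tight, so it contains S; a neighbour of v in S other than u would lie in N A,
   hence not be isolated in A :|: S. *)
Lemma nearly_out_tight u v S : tight S -> u \in S -> nearly_out u v -> out u v.
Proof.
move=> tS0 uS0 /andP[uv /existsP[A /and5P[iA uA pA cA nv]]].
have [|{tS0 uS0} {}S /minsetP[/andP[tS uS] minS] _] :=
  @minset_exists _ (fun S => tight S && (u \in S)) S.
  by rewrite tS0.
have subS B : tight B -> u \in B -> S \subset B.
  move=> tB uB; apply/setIidPl/minS; last exact: subsetIl.
  by rewrite (tightI tS tB uS uB) inE uS.
have [iS /eqP cS] := andP tS.
have iAS : independent G (A :&: S) := independentS (subsetIl A S) iA.
have uAS : u \in A :&: S by rewrite inE uA.
apply: (outP uv tS uS).
(* If [A :&: S] is tight, [S] lies in [A]. Otherwise its surplus exceeds [k], so by submodularity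
   that of [A :|: S] is at most [k]. *)
have [tAS|ntAS] := boolP (tight (A :&: S)).
  apply: contra pA => /(subsetP (nbhS _ _)); apply; apply: setSD.
  exact: subset_trans (subS _ tAS uAS) (subsetIl _ _).
have uI := isolatedU iA iS uA uS.
have /subS/(_ uI)/subsetP sSI : tight (isolated G (A :|: S)).
  apply: isolated_tight uI _.
  move: ntAS; rewrite /tight iAS /=; have := surplus_at uAS iAS.
  have := nbh_submodular (nb G) A S; have := cardsUI A S.
  by move: cA cS; clear; lia.
rewrite mem_nbh; apply/exists_inP => -[x /setD1P[xu xS] xv].
have : x \in u |: N A by apply: (subsetP nv); rewrite inE adj_sym.
rewrite !inE (negbTE xu) mem_nbh => /exists_inP[a aA ax].
have /setIdP[_ /forall_inP/(_ a)] := sSI x xS.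
by rewrite inE aA adj_sym ax => /(_ isT).
Qed.

(** With no tight set at [u], unions have surplus at least [k + 1], so uncrossing works at level
    [k + 1]. Three witnesses would intersect in a set where [u] has three private neighbours, and
    [private_card] allows two. *)
Lemma nearly_out_card u : (forall S, tight S -> u \notin S) ->
  k + 3 <= #|nb G u| -> #|[set v | nearly_out u v]| <= 2.
Proof.
move=> nt du.
pose near A := [&& independent G A, u \in A & #|N A| <= #|A| + k + 1].
have nearI A B : near A -> near B -> near (A :&: B).
  move=> /and3P[iA uA cA] /and3P[iB uB cB].
  apply/and3P; split; first exact: independentS (subsetIl A B) iA.
    by rewrite inE uA.
  have uI := isolatedU iA iB uA uB.
  have : ~~ (#|N (A :|: B)| <= #|A :|: B| + k).
    by apply/negP => /(isolated_tight uI)/nt; rewrite uI.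
  have := nbh_submodular (nb G) A B; have := cardsUI A B.
  by move: cA cB; clear; lia.
rewrite leqNgt; apply/card_gt2P => -[v1 [v2 [v3 [[]]]]].
rewrite !inE => /andP[uv1 /existsP[A1 /and5P[i1 u1 p1 c1 _]]].
move=> /andP[uv2 /existsP[A2 /and5P[i2 u2 p2 c2 _]]].
move=> /andP[uv3 /existsP[A3 /and5P[i3 u3 p3 c3 _]]] [n12 n23 n31].
have n1 : near A1 by apply/and3P.
have n2 : near A2 by apply/and3P.
have n3 : near A3 by apply/and3P.
have /and3P[] := nearI _ _ n1 (nearI _ _ n2 n3).
set A := A1 :&: _ => iA uA cA.
have [A_u|nA] := eqVneq A [set u].
  by move: cA du; rewrite A_u nbh1 cards1; clear; lia.
pose D := v1 |: [set v2; v3].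
have sD : D \subset nb G u by rewrite !subUset !sub1set !inE uv1 uv2.
have dD : [disjoint D & N (A :\ u)].
  have pr v B : A \subset B -> v \notin N (B :\ u) -> v \notin N (A :\ u).
    by move=> sAB; apply: contra; apply/subsetP/nbhS/setSD.
  rewrite disjoints_subset !subUset !sub1set !in_setC.
  rewrite (pr v1 A1) ?(pr v2 A2) ?(pr v3 A3) ?subsetIl //.
    by rewrite (subset_trans (subsetIr _ _)) ?subsetIr.
  by rewrite (subset_trans (subsetIr _ _)) ?subsetIl.
have := private_card iA uA nA sD dD; move: cA.
rewrite cardsU1 cards2 n23 !inE (negbTE n12) eq_sym (negbTE n31) /=; clear; lia.
Qed.

End Tight.

(** * Witnesses for deleted edges and the degree count *)

Section Deletion.
Variables (V : finType) (G : sgraph V) (k : nat).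
Implicit Types (S A : {set V}) (u v x y : V).

Local Notation N := (nbh (nb G)).

Hypothesis surplus :
  forall S, independent G S -> S != set0 -> #|S| + k <= #|N S|.

Lemma del_edgeE u v x y : x != v -> G x y ->
  del_edge G [set u; v] x y = ~~ ((x == u) && (y == v)).
Proof.
move=> xv xy; rewrite /= xy /=; congr (~~ _); apply/eqP/andP; last first.
  by case=> /eqP-> /eqP->.
move=> e; have := set21 x y; rewrite e !inE (negbTE xv) orbF => xu.
split=> //; have := set22 u v; rewrite -e !inE.
by rewrite [v == x]eq_sym (negbTE xv) eq_sym.
Qed.

(** [S :\ v] is independent in [G], and restoring the edge adds at most [v] to its neighbourhood. If
    [v] is outside [S], this forces tightness; otherwise the surplus is at most [k + 1]. *)
Lemma critical_edge_out u v S : G u v ->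
  let N' := nbh (nb (del_edge G [set u; v])) in
  independent (del_edge G [set u; v]) S -> #|N' S| < #|S| + k -> u \in S ->
  out G k u v \/ v \in S /\ nearly_out G k u v.
Proof.
move=> uv N' /independentP iS ltS uS; pose A := S :\ v.
have nuv : u != v by apply: contraTneq uv => ->; rewrite adj_irr.
have uA : u \in A by rewrite in_setD1 nuv.
have iA : independent G A.
  apply/independentP => x y /setD1P[xv xS] /setD1P[yv yS].
  apply: contraFF (iS x y xS yS) => xy.
  by rewrite del_edgeE // (negbTE yv) andbF.
have sNA : N A \subset v |: N' S.
  apply/subsetP => y; rewrite mem_nbh => /exists_inP[x /setD1P[xv xS] xy].
  rewrite in_setU1; have [//|yv] := eqVneq y v; rewrite mem_nbh.
  by apply/exists_inP; exists x; rewrite // del_edgeE // (negbTE yv) andbF.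
have sub_pA : v \in N (A :\ u) -> v \in N' S.
  rewrite !mem_nbh => /exists_inP[x /setD1P[xu /setD1P[xv xS]] xy].
  by apply/exists_inP; exists x; rewrite // del_edgeE // (negbTE xu).
have leA := surplus_at surplus uA iA.
have leNA := subset_leq_card sNA; rewrite cardsU1 in leNA.
have cA := cardsD1 v S; rewrite -/A in cA.
have [vS|vS] := boolP (v \in S); last first.
  left; rewrite (negbTE vS) in cA.
  have vN' : v \notin N' S.
    apply/negP => vN'; move: leNA leA ltS cA.
    by rewrite vN'; clear; lia.
  apply: (@outP _ _ _ _ _ A) => //; last exact: contra sub_pA vN'.
  rewrite /tight iA /=.
  by move: leNA leA ltS cA; rewrite vN'; clear; lia.
rewrite vS in cA.
have vN' : v \notin N' S.
  rewrite mem_nbh; apply/exists_inP => -[x xS xv].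
  by have := iS x v xS vS; rewrite xv.
have pA : v \notin N (A :\ u) by apply: contra sub_pA vN'.
rewrite vN' in leNA.
have [tA|ntA] := boolP (tight G k A); [left; exact: outP tA _ _|right].
split=> //; rewrite /nearly_out uv; apply/existsP; exists A.
apply/and5P; split=> //; first by move: ltS leNA cA; clear; lia.
(* Without tightness all the bounds are equalities, so neighbours of [v] other than [u], being in
   [N' S], lie in [N A]. *)
have eNA : N A = v |: N' S.
  apply/eqP; rewrite eqEcard sNA cardsU1 vN' /=.
  by move: ntA leA leNA ltS cA; rewrite /tight iA /=; clear; lia.
apply/subsetP => y; rewrite inE eNA !in_setU1 => vy.
have [//|yu] := eqVneq y u; apply/orP; right; apply/orP; right.
rewrite mem_nbh; apply/exists_inP; exists v => //.
by rewrite [[set u; v]]setUC del_edgeE // ?(negbTE yu) ?andbF // eq_sym.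
Qed.

Lemma critical_edge u v : k < #|V| -> G u v ->
  ~ factor_critical k (del_edge G [set u; v]) ->
  [\/ out G k u v, out G k v u | nearly_out G k u v /\ nearly_out G k v u].
Proof.
move=> ltkV uv ncrit; have vu : G v u by rewrite adj_sym.
have [S iS] : exists2 S, independent (del_edge G [set u; v]) S &
    #|nbh (nb (del_edge G [set u; v])) S| < #|S| + k /\ S != set0.
  apply: contrapT => h; apply: ncrit; apply: surplus_critical => // S iS S0.
  by rewrite leqNgt; apply/negP => ltS; apply: h; exists S.
case=> ltS S0; have evu : [set u; v] = [set v; u] by rewrite setUC.
have [uS|uS] := boolP (u \in S); have [vS|vS] := boolP (v \in S).
- have := critical_edge_out uv iS ltS uS.
  rewrite evu in iS ltS; have := critical_edge_out vu iS ltS vS.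
  by move=> [?|[_ ?]] [?|[_ ?]];
    [constructor 1|constructor 2|constructor 1|constructor 3].
- have := critical_edge_out uv iS ltS uS.
  by rewrite (negbTE vS) => -[?|[//]]; constructor 1.
- rewrite evu in iS ltS; have := critical_edge_out vu iS ltS vS.
  by rewrite (negbTE uS) => -[?|[//]]; constructor 2.
(* With neither end in [S], the deletion changes neither its independence nor its neighbourhood,
   contradicting [surplus]. *)
have neq x w : x \in S -> w \notin S -> x != w.
  by move=> xS; apply: contraNneq => <-.
have iG : independent G S.
  apply/independentP => x y xS yS.
  apply: contraFF (independentP _ _ iS x y xS yS).
  by move=> xy; rewrite del_edgeE ?neq // (negbTE (neq _ _ xS uS)).
have := surplus iG S0.
suff : #|N S| <= #|nbh (nb (del_edge G [set u; v])) S| by lia.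
apply/subset_leq_card/subsetP => y; rewrite !mem_nbh => /exists_inP[x xS xy].
apply/exists_inP; exists x => //.
by rewrite del_edgeE ?neq // (negbTE (neq _ _ xS uS)).
Qed.

Lemma minimal_degree : k < #|V| ->
  (forall e, e \in edges G -> ~ factor_critical k (del_edge G e)) ->
  exists u, degree G u <= k + 2.
Proof.
move=> ltkV hmin; apply: contrapT => hdeg.
have deg u : k + 3 <= #|nb G u|.
  rewrite addnS ltnNge; apply/negP => du; apply: hdeg; exists u.
  exact: leq_trans du.
pose inT u := [exists S : {set V}, tight G k S && (u \in S)].
pose O u : {set V} := [set v | out G k u v].
pose I u : {set V} := [set v | out G k v u].
(* Inside tight sets [nearly_out] edges are already [out] by [nearly_out_tight], so they are not
   counted again. *)
pose M u : {set V} := if inT u then set0 else [set v | nearly_out G k u v].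
have sum_OI : \sum_u #|O u| = \sum_u #|I u|.
  under eq_bigr do rewrite -sum1dep_card; rewrite (exchange_big_dep xpredT) //=.
  by apply: eq_bigr => u _; rewrite sum1dep_card.
(* The factor [2] accounts for [I], whose sizes have the same sum as those of [O]. *)
have leOM u : #|O u| * 2 + #|M u| <= 2.
  rewrite /M; case: ifPn => [_|nu].
    rewrite cards0; have := @out_card _ _ _ surplus u _; rewrite -/(O u).
    have := deg u; lia.
  have nt S : tight G k S -> u \notin S.
    by move=> tS; apply: contra nu => uS; apply/existsP; exists S; rewrite tS.
  rewrite (_ : O u = set0) ?cards0 ?(nearly_out_card surplus) //.
  apply/setP => v; rewrite !inE; apply/negP => /andP[_ /existsP[S]].
  by case/and3P => /nt/negP.
have nbS u : nb G u \subset O u :|: I u :|: M u.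
  apply/subsetP => v; rewrite inE => uv; rewrite !in_setU.
  have eE : [set u; v] \in edges G.
    by rewrite inE; apply/existsP; exists u; apply/existsP; exists v;
      rewrite uv eqxx.
  have [uvO|uvI|[uvM _]] := critical_edge ltkV uv (hmin _ eE);
    rewrite ?[v \in O u]inE ?[v \in I u]inE ?uvO ?uvI ?orbT //.
  rewrite /M; case: ifPn => [/existsP[S /andP[tS uS]]|_]; last first.
    by rewrite [v \in finset _]inE uvM !orbT.
  by rewrite (nearly_out_tight surplus tS uS uvM).
have : \sum_(u : V) (k + 3) <= \sum_(u : V) 2.
  apply: (@leq_trans (\sum_u (#|O u| + #|I u| + #|M u|))).
    apply: leq_sum => u _; apply: leq_trans (deg u) _.
    apply: leq_trans (subset_leq_card (nbS u)) _.
    by rewrite (leq_trans (leq_card_setU _ _)) // leq_add2r leq_card_setU.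
  rewrite !big_split /= -sum_OI -!big_split /=; apply: leq_sum => u _.
  by have := leOM u; lia.
by rewrite !sum_nat_const leq_pmul2l ?addn3 ?ltnS ?(leq_ltn_trans _ ltkV).
Qed.

End Deletion.

Theorem theorem10 (R : realType) (V : finType) (G : sgraph V) (k : nat) :
  planar R G -> minimal_factor_critical k G ->
  (k + 1 <= min_degree G)%N /\ (min_degree G <= k + 2)%N.
Proof.
move=> _ [crit hmin]; have [ltkV _] := crit.
have surplus S := @critical_surplus V G k S crit.
have degE u : degree G u = #|nb G u| by [].
split.
  (* The default value [#|V|] meets the bound since [k < #|V|]; each degree meets it by the surplus
     of a singleton. *)
  rewrite /min_degree; elim/big_ind: _ => [|m n hm hn|u _]; first by lia.
    by rewrite leq_min hm.
  have := @surplus_at V G k surplus u [set u] (set11 u).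
  rewrite degE nbh1 cards1 addnC; apply.
  by apply/independentP => x y /set1P-> /set1P->; rewrite adj_irr.
have [u du] := minimal_degree surplus ltkV hmin.
apply: leq_trans du; rewrite /min_degree; have := mem_index_enum u.
elim: (index_enum V) => // v s IHs; rewrite inE big_cons geq_min.
by case/orP => [/eqP<-|/IHs->]; rewrite ?leqnn ?orbT.
Qed.
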